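(* Let $Q$ be a $\rho\times N$ integer matrix, let $s\in\mathbb{R}^\rho$, and let $X=\mu_Q^{-1}(s)/U(1)^\rho$ and $\mathbb{X}=(\mathbb{C}^N\setminus E)/(\mathbb{C}^* )^\rho$, where $E$ is the complement of $(\mathbb{C}^* )^N\star\mu_Q^{-1}(s)$ in $\mathbb{C}^N$. Then the natural map $X\to\mathbb{X}$, sending the $U(1)^\rho$-orbit of $z\in\mu_Q^{-1}(s)$ to the $(\mathbb{C}^* )^\rho$-orbit of $z$, is surjective.
   Context: The group $(\mathbb{C}^* )^\rho$ acts on $\mathbb{C}^N$ by $\lambda\star z=(\lambda_1^{Q_{11}}\cdots\lambda_\rho^{Q_{\rho 1}}z_1,\dots,\lambda_1^{Q_{1N}}\cdots\lambda_\rho^{Q_{\rho N}}z_N)$, and $U(1)^\rho\subset(\mathbb{C}^* )^\rho$ acts by restriction. $(\mathbb{C}^* )^N$ acts on $\mathbb{C}^N$ by coordinatewise multiplication, also denoted $\star$. The moment map is $\mu_Q=Q\circ\mu:\mathbb{C}^N\to\mathbb{R}^\rho$, where $\mu:\mathbb{C}^N\to\mathbb{R}^N$, $\mu(z)=\frac12(|z_1|^2,\dots,|z_N|^2)$. No regularity of $s$ and no compactness of $X$ is assumed. $\mathbb{X}$ is the set of $(\mathbb{C}^* )^\rho$-orbits on $\mathbb{C}^N\setminus E=(\mathbb{C}^* )^N\star\mu_Q^{-1}(s)$. *)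

(* Defs.v *)
From HB Require Import structures.
From mathcomp Require Import all_boot all_order all_algebra.
From mathcomp Require Import all_classical all_reals.
From mathcomp Require Export complex.

Set Implicit Arguments.
Unset Strict Implicit.
Unset Printing Implicit Defensive.
Import Order.TTheory GRing.Theory Num.Theory.

Local Open Scope classical_set_scope.
Local Open Scope ring_scope.

Section Tori.
Variables (R : realType) (n : nat).

(* [Cstar R n] and [U1 R n] are the underlying sets of the groups (C^* )^n and
   U(1)^n; the group law is coordinatewise multiplication. *)
Definition Cstar : set 'cV[R[i]]_n := [set t | forall k, t k 0 != 0].

Definition U1 : set 'cV[R[i]]_n := [set t | forall k, `|t k 0| = 1].

Lemma U1_Cstar : U1 `<=` Cstar.
Proof. by move=> t tU k; rewrite -normr_gt0 tU ltr01. Qed.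

(* The standard action of (C^* )^n on C^n. *)
Definition big_act (t z : 'cV[R[i]]_n) : 'cV[R[i]]_n :=
  \col_k (t k 0 * z k 0).

Definition std_moment (z : 'cV[R[i]]_n) : 'cV[R]_n :=
  \col_k (ComplexField.Normc.normc (z k 0) ^+ 2 / 2).

End Tori.

Section Quotients.
Variables (R : realType) (rho N : nat) (Q : 'M[int]_(rho, N)).

Definition act (l : 'cV[R[i]]_rho) (z : 'cV[R[i]]_N) : 'cV[R[i]]_N :=
  \col_j ((\prod_(a < rho) l a 0 ^ Q a j) * z j 0).

Definition moment (z : 'cV[R[i]]_N) : 'cV[R]_rho :=
  map_mx intr Q *m std_moment z.

Definition Cstar_orbit (z : 'cV[R[i]]_N) : set 'cV[R[i]]_N :=
  [set act l z | l in @Cstar R rho].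

Definition U1_orbit (z : 'cV[R[i]]_N) : set 'cV[R[i]]_N :=
  [set act l z | l in @U1 R rho].

Variable s : 'cV[R]_rho.

Definition level : set 'cV[R[i]]_N := [set z | moment z = s].

Definition unstable : set 'cV[R[i]]_N :=
  ~` [set big_act t z | t in @Cstar R N & z in level].

(* A quotient by a group is the set of orbits. *)
Definition symplectic_quotient : set (set 'cV[R[i]]_N) :=
  [set U1_orbit z | z in level].

Definition git_quotient : set (set 'cV[R[i]]_N) :=
  [set Cstar_orbit z | z in ~` unstable].

(* A U(1)^rho-orbit O is sent to its (C^* )^rho-saturation, which is the
   (C^* )^rho-orbit of any z in O: see [orbit_saturate] and
   [natural_map_orbit]. *)
Definition saturate (O : set 'cV[R[i]]_N) : set 'cV[R[i]]_N :=
  \bigcup_(z in O) Cstar_orbit z.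

Lemma act1 z : act (const_mx 1) z = z.
Proof.
apply/colP => j; rewrite !mxE big1 ?mul1r // => a _.
by rewrite mxE exp1rz.
Qed.

Lemma actM l m z : Cstar l -> Cstar m ->
  act l (act m z) = act (big_act l m) z.
Proof.
move=> lC mC; apply/colP => j; rewrite !mxE mulrA -big_split /=.
by congr (_ * _); apply: eq_bigr => a _; rewrite mxE expfzMl.
Qed.

Lemma Cstar_orbit_act l z : Cstar l -> Cstar_orbit (act l z) = Cstar_orbit z.
Proof.
move=> lC; apply/seteqP; split => _ [m mC <-].
  exists (big_act m l); last by rewrite actM.
  by move=> k; rewrite mxE mulf_neq0 ?mC ?lC.
have lVC : Cstar (\col_k (l k 0)^-1) by move=> k; rewrite mxE invr_eq0.
have mlC : Cstar (big_act m (\col_k (l k 0)^-1)).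
  by move=> k; rewrite mxE mulf_neq0 ?mC ?lVC.
exists (big_act m (\col_k (l k 0)^-1)) => //; rewrite actM //.
congr act; apply/colP => k.
by rewrite !mxE -mulrA mulVf ?lC // mulr1.
Qed.

Lemma orbit_saturate z : saturate (U1_orbit z) = Cstar_orbit z.
Proof.
apply/seteqP; split => [w [_ [l lU <-]]|w wz].
  by rewrite Cstar_orbit_act //; apply: U1_Cstar.
exists z => //; exists (const_mx 1); last exact: act1.
by move=> k; rewrite mxE normr1.
Qed.

Lemma level_stable z : level z -> (~` unstable) z.
Proof.
move=> zs; rewrite /unstable setCK; exists (const_mx 1).
  by move=> k; rewrite mxE oner_neq0.
by exists z => //; apply/colP => k; rewrite !mxE mul1r.
Qed.

Lemma saturate_fun : set_fun symplectic_quotient git_quotient saturate.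
Proof.
move=> _ [z zs <-]; rewrite orbit_saturate.
by exists z => //; apply: level_stable.
Qed.

Definition natural_map : {fun symplectic_quotient >-> git_quotient} :=
  mkfun saturate_fun.

Lemma natural_map_orbit z :
  level z -> natural_map (U1_orbit z) = Cstar_orbit z.
Proof. by move=> _; apply: orbit_saturate. Qed.

End Quotients.

(* Main.v *)
Require Import Defs.
From mathcomp Require Import all_boot all_order all_algebra.
From mathcomp Require Import all_classical all_reals.
From mathcomp Require Import all_analysis.
From mathcomp Require Import ring lra.

(** A point of [~` unstable] is [w = t * z] with [z] in the level set, so [w] and
    [z] have the same support [J] and [s = \sum_(j in J) p_j Q_j], where
    [p_j = |z_j|^2 / 2 > 0] and [Q_j] is the [j]-th column of [Q].  Acting on [w]
    by [l_a = exp (x_a / 2)] multiplies [c_j = |w_j|^2 / 2] by [exp y_j], where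
    [y = x Q], so [l] moves [w] into the level set iff [x] is a critical point of
    [x |-> \sum_(j in J) (c_j exp y_j - p_j y_j)].  Each summand is coercive in
    [y_j], hence the sum attains its minimum on the row space of [Q]. *)

Set Implicit Arguments.
Unset Strict Implicit.
Unset Printing Implicit Defensive.
Import Order.TTheory GRing.Theory Num.Theory.
Import numFieldNormedType.Exports.

Local Open Scope classical_set_scope.
Local Open Scope ring_scope.

Section ExpMinusLinear.
Variable R : realType.

(** For negative [u] the term [- p * u] already equals p |u|. For [u >= 0], convexity puts
    [c * expR u] above its tangent of slope [2 * p], which touches at [a]; subtracting [p * u] still
    leaves slope [p]. *)
Lemma expR_sub_linear_coercive (c p : R) : 0 < c -> 0 < p ->
  exists C, forall u, p * `|u| <= c * expR u - p * u + C.
Proof.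
move=> c0 p0; pose a := ln (2 * p / c).
have ca : c * expR a = 2 * p.
  by rewrite lnK ?posrE ?divr_gt0 ?mulr_gt0 // mulrC divfK ?gt_eqF.
exists `|2 * p * (1 - a)| => u.
have absC := ler_norm (- (2 * p * (1 - a))); rewrite normrN in absC.
case: (lerP 0 u) => [u0|u0].
  have : c * expR u >= 2 * p * (1 + (u - a)).
    rewrite -[u in expR u](subrKC a) expRD mulrA ca.
    by rewrite ler_pM2l ?mulr_gt0 // expR_ge1Dx.
  by rewrite ger0_norm //; lra.
have := mulr_gt0 c0 (expR_gt0 u).
have := normr_ge0 (2 * p * (1 - a)).
by rewrite [`|u|]ltr0_norm //; lra.
Qed.

Lemma continuous_expR_sub_linear (T : topologicalType) (g : T -> R) (c p : R) :
  continuous g -> continuous (fun t => c * expR (g t) - p * g t).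
Proof.
move=> gc t; apply: cvgB; last exact: cvgMl_tmp (gc t).
by apply: cvgMl_tmp; apply: continuous_comp (gc t) (@continuous_expR R _).
Qed.

Variables (rho N : nat) (c p : 'I_N -> R).
Hypotheses (c_gt0 : forall j, 0 < c j) (p_gt0 : forall j, 0 < p j).

Let F (y : 'rV[R]_N) : R :=
  \sum_(j < N) (c j * expR (y 0 j) - p j * y 0 j).

Lemma continuous_sum_expR_sub_linear : continuous F.
Proof.
apply: continuous_big => [|j _]; first exact: add_continuous.
by apply: continuous_expR_sub_linear; exact: coord_continuous.
Qed.

Lemma bounded_sublevel_sum_expR_sub_linear (b : R) :
  bounded_set [set y | F y <= b].
Proof.
have /choice[C CP] j := expR_sub_linear_coercive (c_gt0 j) (p_gt0 j).
pose B := b + \sum_j C j.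
(* Adding up the coercivity bounds gives \sum_k p_k |y_k| <= B on the sublevel set, so |y_j| <= |B|
   / p_j for each j; the sum over j dominates all these bounds at once. *)
exists (\sum_j `|B| / p j); split; first exact: num_real.
have pV_ge0 i : 0 <= `|B| / p i by rewrite divr_ge0 // ltW.
move=> M BM y /= Fy.
have M0 : 0 <= M by apply: ltW (le_lt_trans _ BM); exact: sumr_ge0.
rewrite [leLHS]/Num.Def.normr /= mx_normrE bigmax_le // => -[i j] _ /=.
rewrite (ord1 i); apply: le_trans (ltW BM).
rewrite (bigD1 j) //= ler_wpDr ?sumr_ge0 // ler_pdivlMr // mulrC.
apply: le_trans (ler_norm B).
apply: (@le_trans _ _ (F y + \sum_k C k)); last by rewrite lerD2r.
rewrite -big_split /=; apply: (@le_trans _ _ (\sum_k p k * `|y 0 k|)); last first.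
  by apply: ler_sum => k _; exact: CP.
by rewrite (bigD1 j) //= ler_wpDr ?sumr_ge0 // => k _; rewrite mulr_ge0 // ltW.
Qed.

(** The function t |-> F (y + t v) has a minimum at t = 0, so its derivative, the difference of the
    two sides, vanishes there. *)
Lemma critical_of_min (y v : 'rV[R]_N) :
  (forall t, F y <= F (y + t *: v)) ->
  \sum_j v 0 j * (c j * expR (y 0 j)) = \sum_j v 0 j * p j.
Proof.
move=> Fmin.
pose h j t := c j * expR (y 0 j + t * v 0 j) - p j * (y 0 j + t * v 0 j).
have hE t : F (y + t *: v) = (\sum_j h j) t.
  by rewrite fct_sumE; apply: eq_bigr => j _; rewrite !mxE.
have dh j (t : R) : is_derive t (1 : R) (h j)
    (v 0 j * (c j * expR (y 0 j + t * v 0 j)) - v 0 j * p j).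
  have dl : is_derive t 1 (fun u : R => y 0 j + u * v 0 j) (v 0 j).
    rewrite (_ : (fun u => _) = cst (y 0 j) + v 0 j *: id); last first.
      by apply/funext => u; rewrite mulrC.
    by apply: is_derive_eq; rewrite /GRing.scale /=; ring.
  have de := @is_derive1_comp _ _ _ _ _ _ (is_derive_expR _) dl.
  have := is_deriveB (is_deriveZ (c j) de) (is_deriveZ (p j) dl).
  by move/is_derive_eq; apply; rewrite /GRing.scale /=; ring.
have dH t := is_derive_sum (fun j => dh j t).
have d0 : is_derive (0 : R) (1 : R) (\sum_j h j) (0 : R).
  (* Any open interval around 0 would do. *)
  apply: (@derive1_at_min _ _ (-1) 1); rewrite ?in_itv /=; first by lra.
  - by move=> t _; apply: ex_derive.
  - by lra.
  by move=> t _; rewrite -!hE scale0r addr0.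
have := @derive_val _ _ _ _ _ _ _ d0.
rewrite (@derive_val _ _ _ _ _ _ _ (dH 0)) sumrB => /subr0_eq.
by under eq_bigr do rewrite mul0r addr0.
Qed.

End ExpMinusLinear.

(** Equation [a] is criticality, in the direction of row [a] of [M], of a minimiser on the row space
    of [M]. *)
Lemma exists_row_comb_expR (R : realType) (rho N : nat) (M : 'M[R]_(rho, N))
    (c p : 'I_N -> R) :
  (forall j, 0 < c j) -> (forall j, 0 < p j) ->
  exists x : 'rV[R]_rho, forall a,
    \sum_j M a j * (c j * expR ((x *m M) 0 j)) = \sum_j M a j * p j.
Proof.
move=> c0 p0.
pose F (y : 'rV[R]_N) := \sum_(j < N) (c j * expR (y 0 j) - p j * y 0 j).
have Fcont : continuous F by exact: continuous_sum_expR_sub_linear.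
(* The second set is the row space of [M], written as a kernel so that it is closed coordinate by
   coordinate. The sublevel set makes the intersection compact, and its level [F 0] keeps 0
   inside. *)
pose A := [set y | F y <= F 0] `&` [set y | y *m cokermx M = 0].
have A0 : A 0 by split; rewrite /= ?mul0mx.
have Acl : closed A.
  apply: closedI.
    by apply: (closed_comp _ (@closed_le _ (F 0))) => y _; exact: Fcont.
  rewrite [X in closed X](_ : _ =
      \bigcap_(k in setT) [set y | (y *m cokermx M) 0 k = 0]).
    apply: closed_bigI => k _.
    apply: (closed_comp _ (@closed_eq _ 0)) => y _.
    under eq_fun do rewrite mxE.
    move: y; apply: continuous_big => [|j _]; first exact: add_continuous.
    move=> y; exact: continuous_comp (@coord_continuous _ _ _ _ _ y)
      (@mulrr_continuous _ _ _).
  apply/seteqP; split => y /=; first by move=> y0 k _ /=; rewrite y0 mxE.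
  by move=> y0; apply/rowP => k; rewrite y0 // mxE.
have Abd : bounded_set A.
  have [K [Kreal KF]] := bounded_sublevel_sum_expR_sub_linear c0 p0 (F 0).
  by exists K; split=> // B /KF FB y [/FB].
have [y yA ymin] := EVT_min_rV (ex_intro _ _ A0)
  (bounded_closed_compact Abd Acl) (continuous_subspaceT Fcont).
move: yA; rewrite inE => -[/= Fy yM].
have /submxP[x yE] : (y <= M)%MS by rewrite submxE yM.
exists x => a; rewrite -yE.
(* The line stays in the row space; where it leaves [A], [F] exceeds [F 0], which is at least
   [F y]. *)
have yamin t : F y <= F (y + t *: row a M).
  have [le0|/ltW] := lerP (F (y + t *: row a M)) (F 0); last exact: le_trans Fy.
  apply: ymin; rewrite inE; split => //=.
  by rewrite mulmxDl yM add0r -scalemxAl -row_mul mulmx_coker row0 scaler0.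
transitivity (\sum_j row a M 0 j * p j); last first.
  by apply: eq_bigr => j _; rewrite mxE.
rewrite -(critical_of_min yamin); apply: eq_bigr => j _.
by rewrite [row a M 0 j]mxE.
Qed.

Import ComplexField.

Lemma normcXz (R : realType) (z : R[i]) (k : int) :
  Normc.normc (z ^ k) = Normc.normc z ^ k.
Proof.
have nX n : Normc.normc (z ^+ n) = Normc.normc z ^+ n.
  by elim: n => [|n IH]; rewrite ?expr0 ?Normc.normc1 // !exprS Normc.normcM IH.
by case: k => n; rewrite /exprz /= ?Normc.normcV nX.
Qed.

Lemma expRMz (R : realType) (u : R) (k : int) : expR (k%:~R * u) = expR u ^ k.
Proof.
case: k => n; first by rewrite expRM_natl.
by rewrite NegzE mulrNz mulNr expRN expRM_natl.
Qed.

(** The acting entries are positive reals, hence equal to their moduli, and squaring cancels the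
    halves in the exponents. *)
Lemma sqr_normc_act_expR (R : realType) (rho N : nat) (Q : 'M[int]_(rho, N))
    (x : 'rV[R]_rho) (w : 'cV[R[i]]_N) (j : 'I_N) :
  Normc.normc (act Q (\col_a (expR (x 0 a / 2))%:C%C) w j 0) ^+ 2 =
  expR ((x *m map_mx intr Q) 0 j) * Normc.normc (w j 0) ^+ 2.
Proof.
rewrite mxE Normc.normcM exprMn; congr (_ * _).
rewrite (big_morph _ (@Normc.normcM R) (@Normc.normc1 R)) -prodrXl mxE expR_sum.
apply: eq_bigr => a _; rewrite !mxE normcXz /= expr0n addr0 sqrtr_sqr.
rewrite ger0_norm ?expR_ge0 // -expRMz -expRM_natl; congr expR.
by field.
Qed.

Lemma normc_eq0 (R : realType) (z : R[i]) : (Normc.normc z == 0) = (z == 0).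
Proof.
by apply/eqP/eqP => [/Normc.eq0_normc //|->]; exact: Normc.normc0.
Qed.

Lemma stable_meets_level (R : realType) (rho N : nat) (Q : 'M[int]_(rho, N))
    (s : 'cV[R]_rho) (w : 'cV[R[i]]_N) :
  (~` unstable Q s) w -> exists2 l, Cstar l & level Q s (act Q l w).
Proof.
rewrite /unstable setCK => -[t tC [z zs tzw]].
have w0 j : (w j 0 == 0) = (z j 0 == 0).
  by rewrite -tzw mxE mulf_eq0 (negbTE (tC j)).
pose m (v : 'cV[R[i]]_N) j :=
  if w j 0 == 0 then 1 else Normc.normc (v j 0) ^+ 2 / 2.
have m_gt0 (v : 'cV[R[i]]_N) : (forall j, (w j 0 == 0) = (v j 0 == 0)) ->
    forall j, 0 < m v j.
  move=> wv j; rewrite /m; case: ifPn => // wj.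
  by rewrite divr_gt0 // exprn_even_gt0 //= normc_eq0 -wv.
(* Off the support of [w], the columns of [M] vanish and the weights [m] are
   junk: [exists_row_comb_expR] requires them to be positive. *)
pose M : 'M[R]_(rho, N) :=
  \matrix_(a, j) if w j 0 == 0 then 0 else (Q a j)%:~R.
have [x xP] := exists_row_comb_expR M (m_gt0 w (fun=> erefl)) (m_gt0 z w0).
exists (\col_a (expR (x 0 a / 2))%:C%C).
  by move=> a; rewrite mxE eq_complex /= gt_eqF ?expR_gt0.
rewrite /level /= -zs; apply/colP => a.
(* On the support of [w] the columns of [M] are those of [Q]; off it the moment of the moved point
   has zero terms too, since the action fixes zero coordinates. *)
transitivity (\sum_j M a j * (m w j * expR ((x *m M) 0 j))).
  rewrite mxE; apply: eq_bigr => j _; rewrite [in LHS]mxE [std_moment _ _ _]mxE.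
  rewrite sqr_normc_act_expR [M a j]mxE /m; case: ifPn => wj.
    by rewrite (eqP wj) Normc.normc0 expr0n /= mulr0 !mul0r mulr0.
  rewrite (_ : (x *m M) 0 j = (x *m map_mx intr Q) 0 j); first by ring.
  by rewrite !mxE; apply: eq_bigr => b _; rewrite !mxE (negbTE wj).
rewrite xP [RHS]mxE; apply: eq_bigr => j _; rewrite !mxE /m.
case: ifPn => // wj; have := wj; rewrite w0 => /eqP ->.
by rewrite Normc.normc0 expr0n /= !mul0r mulr0.
Qed.

Theorem lemma3p3 (R : realType) (rho N : nat) (Q : 'M[int]_(rho, N))
    (s : 'cV[R]_rho) :
  set_surj (symplectic_quotient Q s) (git_quotient Q s) (natural_map Q s).
Proof.
move=> _ [w wst <-].
have [l lC lw] := stable_meets_level wst.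
(* The saturation of this orbit is the orbit of [act Q l w] under the complex torus, which is that
   of [w]. *)
exists (U1_orbit Q (act Q l w)); first by exists (act Q l w).
by rewrite natural_map_orbit // Cstar_orbit_act.
Qed.
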